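(* Let $S$ be a nonempty finite set. For a minimal separating family $\mathcal{P}$ of bipartitions of $S$, let $G_S(\mathcal{P})$ denote the simple graph with vertex set $S$ in which two distinct vertices $x,y$ are adjacent if and only if there is exactly one bipartition in $\mathcal{P}$ that cuts $x$ and $y$. Then the mapping $\mathcal{P}\mapsto G_S(\mathcal{P})$ is a bijection from the set of all minimal separating families of maximum size for $S$ (i.e. minimal separating families whose cardinality is largest among all minimal separating families for $S$) onto the set of all spanning trees on $S$ (spanning trees of the complete graph on vertex set $S$).
   Context: A partition of a set $S$ is a collection of pairwise disjoint nonempty subsets (components) whose union is $S$. A bipartition of $S$ is a partition of $S$ with at most two components (so $\{S\}$ is a bipartition). A partition $P$ cuts two elements if they lie in different components of $P$. A family $\mathcal{P}$ of bipartitions of a finite set $S$ is a separating family for $S$ if every two distinct elements of $S$ are cut by some bipartition in $\mathcal{P}$. A separating family is minimal if no proper subfamily of it is a separating family for $S$. *)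

(* Defs.v *)
From mathcomp Require Import all_boot.

Set Implicit Arguments.
Unset Strict Implicit.
Unset Printing Implicit Defensive.

Section SeparatingFamilies.

Variable T : finType.
Implicit Types (P : {set {set T}}) (F : {set {set {set T}}}).

Definition bipartition P : bool := partition P [set: T] && (#|P| <= 2).

(* On a partition of [set: T], pblock P x is the component containing x. *)
Definition cuts P (x y : T) : bool := pblock P x != pblock P y.

Definition separating_family F : bool :=
  [forall P in F, bipartition P] &&
  [forall x : T, forall y : T, (x != y) ==> [exists P in F, cuts P x y]].

Definition minimal_separating_family F : bool := minset separating_family F.

Definition maximum_minimal_separating_family F : bool :=
  minimal_separating_family F &&
  [forall F' : {set {set {set T}}},
    minimal_separating_family F' ==> (#|F'| <= #|F|)].

End SeparatingFamilies.

(* A simple graph with vertex set T is represented by its set of edges, a set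
   of two-element subsets of T; thus equality of graphs is Leibniz equality. *)
Section SimpleGraphs.

Variable T : finType.
Implicit Type E : {set {set T}}.

Definition complete_edges : {set {set T}} := [set e : {set T} | #|e| == 2].

Definition adjacent E : rel T := fun x y => [set x; y] \in E.

Definition connected_graph E : Prop :=
  forall x y : T, connect (adjacent E) x y.

(* The bound 2 < size c discards [:: x; y] for an edge {x, y}, which is a
   ucycle of a symmetric relation but not a cycle of the graph. *)
Definition acyclic_graph E : Prop :=
  forall c : seq T, 2 < size c -> ~ ucycle (adjacent E) c.

Definition spanning_tree E : Prop :=
  [/\ E \subset complete_edges, connected_graph E & acyclic_graph E].

End SimpleGraphs.

Definition separation_graph (T : finType) (F : {set {set {set T}}}) :
    {set {set T}} :=
  [set e : {set T} | [exists x : T, exists y : T,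
    [&& x != y, e == [set x; y] & #|[set P in F | cuts P x y]| == 1]]].

(* Main.v *)
(* In a minimal separating family F every P is the only member of F cutting some
   pair.  Fix a vertex r.  Sending a subfamily B of F to the set of vertices x
   such that an odd number of members of B cut r and x is injective: P is in B
   exactly when the image separates the pair that only P cuts.  The images omit
   r, so 2 ^ #|F| <= 2 ^ #|T|.-1, and stars attain this bound.  In the case of
   equality every set omitting r is such an image; this forces the graph of F to
   be connected and each P to cut exactly one edge of it, so that every edge is
   a bridge.  Then P is determined by its edge, because the cuts of P are known
   along all edges of a connected graph.  Conversely, the two sides of each
   edge of a tree form a minimal separating family of size #|T|.-1. *)
Require Import Defs.
From mathcomp Require Import all_boot.

Set Implicit Arguments.
Unset Strict Implicit.
Unset Printing Implicit Defensive.

(** * Cuts of bipartitions, and the bipartition given by a vertex set *)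

Section Cuts.

Variable T : finType.
Implicit Types (P : {set {set T}}) (x y z : T).

Lemma cutsxx P x : cuts P x x = false.
Proof. by rewrite /cuts eqxx. Qed.

Lemma cutsC P x y : cuts P x y = cuts P y x.
Proof. by rewrite /cuts eq_sym. Qed.

(** Were [x], [y], [z] in three different components, [P] would have more than two. This additivity
    modulo 2 drives all later parity arguments. *)
Lemma cuts_addb P x y z : bipartition P -> cuts P x y = cuts P z x (+) cuts P z y.
Proof.
case/andP=> /and3P[/eqP covP _ _] leP2; rewrite /cuts.
have inP w : pblock P w \in P by rewrite pblock_mem ?covP ?inE.
have [<-|zx] := eqVneq (pblock P z) (pblock P x); first by [].
have [<-|zy] := eqVneq (pblock P z) (pblock P y); first by rewrite eq_sym zx.
have [//|xy] := eqVneq (pblock P x) (pblock P y).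
have: #|pblock P z |: [set pblock P x; pblock P y]| <= #|P|.
  by apply/subset_leq_card/subsetP=> b /setU1P[|/set2P[]] ->.
by rewrite cardsU1 cards2 !inE negb_or zx zy xy leqNgt ltnS leP2.
Qed.

Lemma eq_cuts P Q : partition P [set: T] -> partition Q [set: T] ->
  cuts P =2 cuts Q -> P = Q.
Proof.
move=> partP partQ eqPQ.
rewrite -(equivalence_partition_pblock partP).
rewrite -(equivalence_partition_pblock partQ).
have mem_pblockE (R : {set {set T}}) x y :
    partition R setT -> (y \in pblock R x) = ~~ cuts R x y.
  case/and3P=> /eqP covR tiR _.
  by rewrite /cuts negbK eq_pblock ?covR ?inE.
apply: eq_imset => x; apply/setP=> y.
by rewrite !inE /= !mem_pblockE // eqPQ.
Qed.

(** Grouping by membership, instead of pairing [A] with its complement, creates no empty component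
    when [A] is empty or full. *)
Definition side_partition (A : {set T}) : {set {set T}} :=
  preim_partition (mem A) [set: T].

Lemma side_bipartition A : bipartition (side_partition A).
Proof.
rewrite /bipartition preim_partitionP /=.
pose f b := [set y | y \in [set: T] & b == (y \in A)].
suff /subset_leq_card/leq_trans -> : side_partition A \subset [set f true; f false] => //.
  by rewrite cards2; case: (_ != _).
apply/subsetP=> _ /imsetP[x _ ->]; rewrite !inE.
by apply/orP; case: (boolP (x \in A)) => xA; [left|right];
  apply/eqP/setP=> y; rewrite !inE /= ?xA ?(negPf xA).
Qed.

Lemma cuts_side A x y : cuts (side_partition A) x y = (x \in A) (+) (y \in A).
Proof.
have /and3P[/eqP cov ti _] := preim_partitionP (mem A) [set: T].
rewrite /cuts eq_pblock ?cov ?inE // pblock_equivalence_partition ?inE //=.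
  by rewrite negb_eqb.
by split=> // /eqP ->.
Qed.

End Cuts.

(** * Bridges, cycles and edge counts in graphs given by edge sets *)

Section Graphs.

Variable T : finType.
Implicit Types (E : {set {set T}}) (x y : T).

Lemma connect_const (e : rel T) (f : T -> bool) :
  (forall x y, e x y -> f x = f y) ->
  forall x y, connect e x y -> f x = f y.
Proof. exact: closed_connect. Qed.

Lemma adjacentC E : symmetric (adjacent E).
Proof. by move=> x y; rewrite /adjacent setUC. Qed.

Lemma set2_eq x y z t : [set x; y] = [set z; t] ->
  x = z /\ y = t \/ x = t /\ y = z.
Proof.
move=> eqS.
have /set2P xzt : x \in [set z; t] by rewrite -eqS set21.
have /set2P yzt : y \in [set z; t] by rewrite -eqS set22.
have /set2P zxy : z \in [set x; y] by rewrite eqS set21.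
have /set2P txy : t \in [set x; y] by rewrite eqS set22.
by intuition congruence.
Qed.

Lemma set2_neq x y z t : t != x -> t != y -> [set t; z] != [set x; y].
Proof.
move=> tx ty; apply: contraNneq tx => eq_tz.
by have := set21 t z; rewrite eq_tz !inE (negPf ty) orbF.
Qed.

Definition bridge E x y := ~~ connect (adjacent (E :\ [set x; y])) x y.

(** Removing one edge of a cycle leaves the rest of the cycle as a path joining its ends. *)
Lemma bridges_acyclic E :
  (forall x y, x != y -> [set x; y] \in E -> bridge E x y) -> acyclic_graph E.
Proof.
move=> brE [|x [|y [|z p]]] // _ /andP[]; rewrite [cycle _ _]/=.
case/and3P=> Exy Eyz; rewrite rcons_path => /andP[Ep Elast].
case/andP=> xNp uniqp; have xy : x != y.
  by apply: contraNneq xNp => ->; rewrite mem_head.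
have /negP[] := brE x y xy Exy.
rewrite (sym_connect_sym (@adjacentC _)); apply/connectP.
exists (rcons (z :: p) x); last by rewrite last_rcons.
rewrite rcons_path; apply/andP; split.
  have: path (adjacent E) y (z :: p) by rewrite /= Eyz.
  (* Up to the closing edge, the path stays away from [x], so it cannot use the deleted edge. *)
  apply: (@sub_in_path _ (predC1 x)); last first.
    by apply/allP=> w wp; apply: contraNneq xNp => <-.
  move=> u v ux vx Euv; rewrite /adjacent in_setD1 [_ \in E]Euv andbT.
  by apply/eqP=> /setP/(_ x); rewrite !inE eqxx ![x == _]eq_sym (negPf ux) (negPf vx).
rewrite /adjacent in_setD1 [_ \in E]Elast andbT.
(* The closing edge leaves from the last vertex, which differs from [x] and from [y] because the
   cycle has at least three distinct vertices. *)
apply: set2_neq.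
  by apply: contraNneq xNp => <- /=; rewrite inE mem_last orbT.
by case/andP: uniqp => yNp _; apply: contraNneq yNp => <- /=; rewrite mem_last.
Qed.

(** A simple path from [x] to [y] that avoids their edge has an inner vertex, so that edge closes it
    to a cycle. *)
Lemma acyclic_bridge E x y :
  acyclic_graph E -> x != y -> [set x; y] \in E -> bridge E x y.
Proof.
move=> acE xy Exy; apply/negP=> /connectP[p pathp].
case/shortenP: pathp => q pathq uniqq _ def_y.
case: q => [|z [|t q]] in pathq uniqq def_y *; first by rewrite def_y eqxx in xy.
  by move: pathq; rewrite def_y /= andbT /adjacent !inE eqxx.
apply: (acE [:: x, z, t & q]) => //; apply/andP; split; last by [].
rewrite -[cycle _ _]/(path _ x (rcons [:: z, t & q] x)) rcons_path -def_y.
rewrite adjacentC [adjacent _ _ _]Exy andbT.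
by apply: sub_path pathq => u v /setD1P[].
Qed.

(** A simple path never returns to [x], hence does not reuse its first edge. *)
Lemma connect_first_edge E x y : connect (adjacent E) x y -> x != y ->
  exists z, [/\ x != z, [set x; z] \in E
    & connect (adjacent (E :\ [set x; z])) z y].
Proof.
case/connectP=> p pathp.
case/shortenP: pathp => -[|z q] pathq uniqq _ def_y; first by rewrite def_y eqxx.
move=> _; move: pathq uniqq => /= /andP[Exz pathq] /andP[xNq _].
exists z; split=> //; first by apply: contraNneq xNq => ->; rewrite mem_head.
apply/connectP; exists q => //; move: pathq.
apply: (@sub_in_path _ (predC1 x)); last first.
  by apply/allP=> w wp; apply: contraNneq xNq => <-.
move=> u v ux vx Euv; rewrite /adjacent in_setD1 [_ \in E]Euv andbT.
by apply/eqP=> /setP/(_ x); rewrite !inE eqxx ![x == _]eq_sym (negPf ux) (negPf vx).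
Qed.

(** In a connected graph, a vertex set omitting [r] is determined by the edges with exactly one end
    in it; comparing power sets gives the bound. *)
Lemma connected_card E : connected_graph E -> #|T|.-1 <= #|E|.
Proof.
move=> conE; case: (pickP T) => [r _|T0]; last by rewrite (eq_card0 (T0 : T =i pred0)).
pose bd (A : {set T}) := [set e in E | ~~ (e \subset A) & ~~ (e \subset ~: A)].
have bdE A x y : [set x; y] \in E ->
    ([set x; y] \in bd A) = (x \in A) (+) (y \in A).
  move=> Exy; rewrite inE Exy /= !subUset !sub1set !inE.
  by do 2 case: (_ \in A).
have bd_inj : {in powerset [set~ r] &, injective bd}.
  move=> A B; rewrite !inE => sA sB eqAB.
  have notr (C : {set T}) : C \subset [set~ r] -> r \notin C.
    by move/subsetP=> sC; apply/negP=> /sC; rewrite !inE eqxx.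
  apply/setP=> x.
  (* Sets with equal boundary have a symmetric difference that is constant along edges; it omits
     [r], so it is empty. *)
  have := @connect_const _ (fun u => (u \in A) (+) (u \in B)) _ r x (conE r x).
  rewrite (negPf (notr A sA)) (negPf (notr B sB)).
  have step u v : adjacent E u v ->
      (u \in A) (+) (u \in B) = (v \in A) (+) (v \in B).
    move=> Euv; have := bdE A u v Euv; rewrite eqAB bdE //.
    by do 4 case: (_ \in _).
  by move/(_ step); do 2 case: (_ \in _).
rewrite -(@leq_exp2l 2) // -(cardsC1 r) -!card_powerset -(card_in_imset bd_inj).
apply/subset_leq_card/subsetP=> _ /imsetP[A _ ->]; rewrite inE.
by apply/subsetP=> e /[!inE] /andP[].
Qed.

(** The component of one end of [e] once [e] is deleted. Which end is picked is irrelevant, since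
    only the parity of membership of two vertices is used; [set0] occurs only for empty [e]. *)
Definition edge_side E (e : {set T}) : {set T} :=
  if [pick x in e] is Some x
  then [set u | connect (adjacent (E :\ e)) x u] else set0.

(** Any edge other than [e] survives the deletion and keeps its ends together, while [e] is a
    bridge. *)
Lemma edge_side_edge E e x y : acyclic_graph E -> x != y -> [set x; y] \in E ->
  (x \in edge_side E e) (+) (y \in edge_side E e) = (e == [set x; y]).
Proof.
move=> acE xy Exy; have csym := sym_connect_sym (@adjacentC (E :\ e)).
rewrite /edge_side; case: pickP => [z ez|e0]; last first.
  by rewrite !inE; case: eqP => // exy; have := e0 x; rewrite exy set21.
rewrite !inE; case: eqVneq => [exy | exy]; last first.
  rewrite (same_connect_r csym (connect1 _ : connect _ x y)) ?addbb //.
  by apply/setD1P; rewrite eq_sym.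
have br : ~~ connect (adjacent (E :\ e)) x y by rewrite exy; apply: acyclic_bridge.
move: ez; rewrite {1}exy => /set2P[] ->; rewrite connect0.
  by rewrite (negPf br).
by rewrite csym (negPf br).
Qed.

(** The witness is the first edge of a simple path from [x] to [y]: the rest of the path keeps [y]
    on the side of the far end. *)
Lemma edge_side_separates E x y :
  connected_graph E -> acyclic_graph E -> x != y ->
  exists2 e, e \in E & (x \in edge_side E e) (+) (y \in edge_side E e).
Proof.
move=> conE acE xy; have [z [xz Exz zy]] := connect_first_edge (conE x y) xy.
exists [set x; z] => //; have := edge_side_edge [set x; z] acE xz Exz.
suff -> : (z \in edge_side E [set x; z]) = (y \in edge_side E [set x; z]).
  by rewrite eqxx.
rewrite /edge_side; case: pickP => [w _|_]; rewrite !inE //.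
by rewrite (same_connect_r (sym_connect_sym (@adjacentC _)) zy).
Qed.

End Graphs.

(** * Minimal separating families: sole cuts, parity sides and the size bound *)

Section Families.

Variable T : finType.
Implicit Types (F B : {set {set {set T}}}) (P Q : {set {set T}}).

Definition sole_cut F P x y := forall Q, Q \in F -> cuts Q x y = (Q == P).

Lemma sole_cutC F P x y : sole_cut F P x y -> sole_cut F P y x.
Proof. by move=> cutP Q FQ; rewrite cutsC cutP. Qed.

Lemma separation_graphP F x y :
  reflect (exists2 P, P \in F & sole_cut F P x y)
          ([set x; y] \in separation_graph F).
Proof.
rewrite inE; apply: (iffP existsP) => [[u /existsP[v]] | [P FP cutP]].
  case/and3P=> _ /eqP/set2_eq exy /cards1P[P defP].
  have cut_uv : sole_cut F P u v.
    move=> Q FQ; have := congr1 (fun A : {set _} => Q \in A) defP.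
    by rewrite !inE FQ.
  have FP : P \in F.
    by have := set11 P; rewrite -defP inE => /andP[].
  exists P => //.
  case: exy => -[-> ->] //; exact: sole_cutC.
exists x; apply/existsP; exists y; rewrite eqxx /=; apply/andP; split.
  by apply/eqP=> xy; have := cutP P FP; rewrite xy cutsxx eqxx.
apply/cards1P; exists P; apply/setP=> Q; rewrite !inE.
by case: (boolP (Q \in F)) => [/cutP // | FQ]; apply/esym/eqP=> QP; rewrite QP FP in FQ.
Qed.

Lemma separation_graph_complete F : separation_graph F \subset complete_edges T.
Proof.
apply/subsetP=> e; rewrite !inE => /existsP[x /existsP[y /and3P[xy /eqP-> _]]].
by rewrite cards2 xy.
Qed.

Lemma separating_bipartition F P :
  separating_family F -> P \in F -> bipartition P.
Proof. by case/andP=> /forall_inP bipF _; apply: bipF. Qed.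

(** Dropping [P] leaves some pair uncut, and [F] cuts that pair, so only [P] does. *)
Lemma minimal_sole_cut F P : minimal_separating_family F -> P \in F ->
  exists x y, sole_cut F P x y.
Proof.
case/minsetP=> sepF minF FP.
have: ~~ separating_family (F :\ P).
  apply/negP=> sepFP; have := minF _ sepFP (subD1set F P).
  by move/setP/(_ P); rewrite !inE eqxx FP.
case/andP: (sepF) => /forall_inP bipF /forallP sep; rewrite negb_and.
case/orP=> [/negP[]|]; first by apply/forall_inP=> Q /setD1P[_ /bipF].
rewrite negb_forall => /existsP[x]; rewrite negb_forall => /existsP[y].
rewrite negb_imply => /andP[xy]; rewrite negb_exists => /forallP nocut.
exists x, y => Q FQ; have [->|QP] := eqVneq Q P; last first.
  by have := nocut Q; rewrite !inE FQ QP /= => /negbTE.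
have /forallP/(_ y)/implyP/(_ xy)/exists_inP[R FR cutR] := sep x.
have [<- //|RP] := eqVneq R P.
by have := nocut R; rewrite !inE FR RP cutR.
Qed.

(* Additivity of cuts modulo 2 makes this the symmetric difference, over P in B,
   of the components of P that omit r. *)
Definition parity_side (r : T) B : {set T} :=
  [set x | \big[addb/false]_(P in B) cuts P r x].

Lemma parity_side_addb F r B x y : separating_family F -> B \subset F ->
  (x \in parity_side r B) (+) (y \in parity_side r B) =
  \big[addb/false]_(P in B) cuts P x y.
Proof.
move=> sepF /subsetP sBF; rewrite !inE -big_split; apply: eq_bigr => P /sBF FP.
by rewrite [RHS](cuts_addb _ _ r) ?(separating_bipartition sepF).
Qed.

(** In the parity sum over [B] only the term of [P] can be true. Thus [B] can be read off from its
    image. *)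
Lemma parity_side_sole F r B P x y : separating_family F -> B \subset F ->
  sole_cut F P x y ->
  (x \in parity_side r B) (+) (y \in parity_side r B) = (P \in B).
Proof.
move=> sepF sBF cutP; rewrite (parity_side_addb _ _ _ sepF sBF).
rewrite (eq_bigr (fun Q => Q == P)) => [|Q /(subsetP sBF)/cutP //].
have [BP|BP] := boolP (P \in B).
  rewrite (bigD1 P) //= eqxx big1 // => Q /andP[_ /negbTE //].
by rewrite big1 // => Q BQ; apply/eqP=> QP; rewrite -QP BQ in BP.
Qed.

Section MinimalFamily.

Variables (F : {set {set {set T}}}) (r : T).
Hypothesis minF : minimal_separating_family F.

Let sepF : separating_family F. Proof. exact: minsetp minF. Qed.

Lemma parity_side_inj : {in powerset F &, injective (parity_side r)}.
Proof.
move=> B C; rewrite !inE => sBF sCF eqBC; apply/setP=> P.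
have [FP|FP] := boolP (P \in F); last first.
  by rewrite (contraNF (subsetP sBF P) FP) (contraNF (subsetP sCF P) FP).
have [x [y cutP]] := minimal_sole_cut minF FP.
rewrite -(parity_side_sole r sepF sBF cutP).
by rewrite -(parity_side_sole r sepF sCF cutP) eqBC.
Qed.

Lemma parity_side_sub : parity_side r @: powerset F \subset powerset [set~ r].
Proof.
apply/subsetP=> _ /imsetP[B _ ->]; rewrite inE; apply/subsetP=> x.
rewrite !inE; apply: contraL => /eqP->.
by rewrite big1 // => P _; rewrite cutsxx.
Qed.

Lemma card_minimal_family : #|F| <= #|T|.-1.
Proof.
rewrite -(@leq_exp2l 2) // -(cardsC1 r) -!card_powerset.
by rewrite -(card_in_imset parity_side_inj) subset_leq_card ?parity_side_sub.
Qed.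

(** An injection between finite sets of equal size is onto. *)
Lemma parity_side_surj (A : {set T}) : #|F| = #|T|.-1 -> r \notin A ->
  exists2 B : {set {set {set T}}}, B \subset F & A = parity_side r B.
Proof.
move=> cardF rA.
have: parity_side r @: powerset F == powerset [set~ r].
  rewrite eqEcard parity_side_sub (card_in_imset parity_side_inj).
  by rewrite !card_powerset cardsC1 cardF leqnn.
move/eqP/setP/(_ A); rewrite inE.
have -> : A \subset [set~ r].
  by apply/subsetP=> x Ax; rewrite !inE; apply: contraNneq rA => <-.
by case/imsetP=> B; rewrite inE; exists B.
Qed.

End MinimalFamily.

(** * Families attaining the bound: their graphs are trees and determine them *)

Section LargestFamily.

Variable F : {set {set {set T}}}.
Hypotheses (minF : minimal_separating_family F) (cardF : #|F| = #|T|.-1).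

Let sepF : separating_family F. Proof. exact: minsetp minF. Qed.

(** If [x] and [u] differ, realise [[set x]] as a parity side based at [u]. It separates [x] from
    [y], so its subfamily contains [P]; hence it separates [u] from [v] too, which forces [v = x],
    and [P] cuts [x] from [u]. *)
Lemma sole_cut_inj_side P x y u v : P \in F ->
  sole_cut F P x y -> sole_cut F P u v -> ~~ cuts P x u -> x = u.
Proof.
move=> FP cutxy cutuv; apply: contraNeq => xu.
have [B sBF defA] : exists2 B : {set {set {set T}}}, B \subset F
    & [set x] = parity_side u B.
  by apply: parity_side_surj => //; rewrite inE eq_sym.
have := parity_side_sole u sepF sBF cutxy.
rewrite -(parity_side_sole u sepF sBF cutuv) -defA !inE eqxx.
have xy : y != x.
  by apply/eqP=> xy; have := cutxy P FP; rewrite xy cutsxx eqxx.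
rewrite (negPf xy) eq_sym (negPf xu) /=; move/esym/eqP <-.
by rewrite cutsC cutuv.
Qed.

Lemma sole_cut_inj P x y u v : P \in F ->
  sole_cut F P x y -> sole_cut F P u v -> [set x; y] = [set u; v].
Proof.
move=> FP cutxy cutuv; have bipP := separating_bipartition sepF FP.
(* [P] cuts [u] from [v], so one of them lies on the side of [x]; swap them if it is [v]. *)
wlog xu : u v cutuv / ~~ cuts P x u => [IH|].
  have [|cut_xu] := boolP (~~ cuts P x u); first exact: IH.
  rewrite [RHS]setUC; apply: IH; first exact: sole_cutC.
  by rewrite (cuts_addb _ _ u) // cutsC (negbNE cut_xu) cutuv ?eqxx.
rewrite (sole_cut_inj_side FP cutxy cutuv xu).
rewrite (sole_cut_inj_side FP (sole_cutC cutxy) (sole_cutC cutuv)) //.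
rewrite (cuts_addb _ _ x) // cutxy // eqxx (cuts_addb x v u) //.
by rewrite cutuv // eqxx cutsC (negPf xu).
Qed.

(** The vertices unreachable from [x] form the parity side of some [B]. A member of [B] would have a
    sole pair that is an edge with exactly one end in this set, so [B] and the set are empty. *)
Lemma largest_connected : connected_graph (separation_graph F).
Proof.
move=> x y; apply: contraT => xNy.
pose A := [set z | ~~ connect (adjacent (separation_graph F)) x z].
have [B sBF defA] : exists2 B : {set {set {set T}}}, B \subset F
    & A = parity_side x B.
  by apply: parity_side_surj => //; rewrite inE connect0.
have /set0Pn[P BP] : B != set0.
  apply: contraTneq isT => B0; have: y \in A by rewrite inE.
  by rewrite defA B0 inE big_set0.
have FP := subsetP sBF P BP; have [u [v cutP]] := minimal_sole_cut minF FP.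
have := parity_side_sole x sepF sBF cutP; rewrite BP -defA !inE.
rewrite (same_connect_r (sym_connect_sym (@adjacentC _ _)) (connect1 _ : connect _ u v)) ?addbb //.
by apply/separation_graphP; exists P.
Qed.

Lemma largest_no_cut P x y u v : P \in F -> sole_cut F P x y ->
  adjacent (separation_graph F :\ [set x; y]) u v -> cuts P u v = false.
Proof.
move=> FP cutxy /setD1P[uv_xy /separation_graphP[Q FQ cutuv]].
rewrite cutuv //; apply: contraNF uv_xy => /eqP PQ; rewrite -PQ in cutuv.
by rewrite (sole_cut_inj FP cutxy cutuv).
Qed.

(** The sole cutter [P] of the edge cuts no other edge, so without it the side of [P] is constant
    along paths. *)
Lemma largest_bridge x y :
  [set x; y] \in separation_graph F -> bridge (separation_graph F) x y.
Proof.
case/separation_graphP=> P FP cutxy; apply/negP.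
move/(@connect_const _ _ (cuts P x)) => con.
have := cutxy P FP; rewrite eqxx -con ?cutsxx // => u v /(largest_no_cut FP cutxy).
rewrite (cuts_addb u v x) ?(separating_bipartition sepF) //.
by do 2 case: (cuts _ _ _).
Qed.

Lemma largest_spanning_tree : spanning_tree (separation_graph F).
Proof.
split; [exact: separation_graph_complete | exact: largest_connected |].
by apply: bridges_acyclic => x y _; apply: largest_bridge.
Qed.

End LargestFamily.

(** Members of the two families with the same edge agree on every edge of a connected graph, hence
    on all pairs. *)
Lemma largest_separation_graph_sub F1 F2 :
  minimal_separating_family F1 -> #|F1| = #|T|.-1 ->
  minimal_separating_family F2 -> #|F2| = #|T|.-1 ->
  separation_graph F1 = separation_graph F2 -> F1 \subset F2.
Proof.
move=> min1 card1 min2 card2 eqG; apply/subsetP=> P FP.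
have [x [y cutP]] := minimal_sole_cut min1 FP.
have: [set x; y] \in separation_graph F2.
  by rewrite -eqG; apply/separation_graphP; exists P.
case/separation_graphP=> Q FQ cutQ.
have bipP := separating_bipartition (minsetp min1) FP.
have bipQ := separating_bipartition (minsetp min2) FQ.
suff -> : P = Q by [].
apply: eq_cuts; [by case/andP: bipP | by case/andP: bipQ |].
have con u v : adjacent (separation_graph F1) u v ->
    cuts P x u (+) cuts Q x u = cuts P x v (+) cuts Q x v.
  move=> Guv; suff: cuts P u v = cuts Q u v.
    rewrite (cuts_addb u v x bipP) (cuts_addb u v x bipQ).
    by do 4 case: (cuts _ _ _).
  have [uv_xy|uv_xy] := eqVneq [set u; v] [set x; y].
    case/set2_eq: uv_xy => -[-> ->]; first by rewrite cutP // cutQ // !eqxx.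
    by rewrite cutsC cutP // cutsC cutQ // !eqxx.
  rewrite (largest_no_cut min1 card1 FP cutP) ?(largest_no_cut min2 card2 FQ cutQ) //.
    by rewrite -eqG; apply/setD1P.
  exact/setD1P.
have cutPQ u : cuts P x u = cuts Q x u.
  have := connect_const con (largest_connected min1 card1 x u).
  by rewrite !cutsxx; do 2 case: (cuts _ _ _).
by move=> u v; rewrite (cuts_addb u v x bipP) (cuts_addb u v x bipQ) !cutPQ.
Qed.

(** * Minimal families built from vertex sets, for stars and for trees *)

Section SideFamilies.

Variables (I : finType) (D : {set I}) (s : I -> {set T}).

Definition side_family := [set side_partition (s i) | i in D].

Hypothesis dual : forall i, i \in D ->
  exists x y, forall j, j \in D -> (x \in s j) (+) (y \in s j) = (j == i).
Hypothesis separates : forall x y, x != y ->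
  exists2 i, i \in D & (x \in s i) (+) (y \in s i).

(** By [dual] each member has a pair that it alone cuts, so a separating subfamily must keep it. *)
Lemma side_family_minimal : minimal_separating_family side_family.
Proof.
apply/minsetP; split=> [|B sepB sBF].
  apply/andP; split.
    by apply/forall_inP=> _ /imsetP[i _ ->]; apply: side_bipartition.
  apply/forallP=> x; apply/forallP=> y; apply/implyP=> /separates[i Di cuti].
  apply/exists_inP; exists (side_partition (s i)); first exact: imset_f.
  by rewrite cuts_side.
apply/eqP; rewrite eqEsubset sBF; apply/subsetP=> _ /imsetP[i Di ->].
have [x [y cutxy]] := dual Di.
have xy : x != y.
  by apply/eqP=> xy; have := cutxy i Di; rewrite xy addbb eqxx.
case/andP: sepB => _ /forallP/(_ x)/forallP/(_ y)/implyP/(_ xy).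
case/exists_inP=> P BP; have /imsetP[j Dj defP] := subsetP sBF P BP.
by rewrite defP cuts_side cutxy // => /eqP <-; rewrite -defP.
Qed.

Lemma side_partition_inj : {in D &, injective (fun i => side_partition (s i))}.
Proof.
move=> i j Di Dj /= eqij; have [x [y cutxy]] := dual Di.
apply/esym/eqP; rewrite -cutxy // -cuts_side -eqij cuts_side.
by rewrite cutxy ?eqxx.
Qed.

Lemma card_side_family : #|side_family| = #|D|.
Proof. exact: card_in_imset side_partition_inj. Qed.

End SideFamilies.

(** The sides are the singletons other than [[set r]]; the one of [i] is alone in cutting the pair
    of [r] and [i]. *)
Lemma star_family (r : T) : exists2 F : {set {set {set T}}},
  minimal_separating_family F & #|F| = #|T|.-1.
Proof.
have dual i : i \in [set~ r] -> exists x y, forall j, j \in [set~ r] ->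
    (x \in [set j]) (+) (y \in [set j]) = (j == i).
  move=> ri; exists r, i => j; rewrite !inE => jr.
  by rewrite ![_ == j]eq_sym (negPf jr).
exists (side_family [set~ r] set1); last by rewrite card_side_family ?cardsC1.
apply: side_family_minimal => // x y xy; have [xr|xr] := eqVneq x r.
  by exists y; rewrite !inE ?eqxx ?addbT // -xr eq_sym.
by exists x; rewrite !inE // eqxx addTb eq_sym xy.
Qed.

Lemma maximum_minimal_card F : 0 < #|T| ->
  maximum_minimal_separating_family F <->
  minimal_separating_family F /\ #|F| = #|T|.-1.
Proof.
case/card_gt0P=> r _; split=> [/andP[minF /forallP maxF]|[minF cardF]].
  split=> //; apply/eqP; rewrite eqn_leq (card_minimal_family r minF).
  have [F0 minF0 <-] := star_family r.
  exact: implyP (maxF F0) minF0.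
apply/andP; split=> //; apply/forallP=> F'; apply/implyP=> minF'.
by rewrite cardF (card_minimal_family r).
Qed.

Lemma spanning_tree_family (E : {set {set T}}) : 0 < #|T| -> spanning_tree E ->
  exists F : {set {set {set T}}}, [/\ minimal_separating_family F, #|F| = #|T|.-1
    & separation_graph F = E].
Proof.
case/card_gt0P=> r _ [/subsetP cE conE acE].
have edgeP e : e \in E -> exists x y, [/\ e = [set x; y], x != y
    & forall f, f \in E ->
      (x \in edge_side E f) (+) (y \in edge_side E f) = (f == e)].
  move=> Ee; have := cE e Ee; rewrite inE => /cards2P[x [y [xy defe]]].
  exists x, y; split=> // f _; rewrite edge_side_edge -?defe //.
have dual e : e \in E -> exists x y, forall f, f \in E ->
    (x \in edge_side E f) (+) (y \in edge_side E f) = (f == e).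
  by case/edgeP=> x [y [_ _ cutxy]]; exists x, y.
pose F := side_family E (edge_side E).
have minF : minimal_separating_family F.
  by apply: side_family_minimal => // x y; apply: edge_side_separates.
have cardFE : #|F| = #|E| by apply: card_side_family.
have cardF : #|F| = #|T|.-1.
  (* The bound on minimal families gives one inequality, connectedness of [E] the other; this also
     counts the edges of the tree. *)
  apply/eqP; rewrite eqn_leq (card_minimal_family r minF) cardFE.
  exact: connected_card.
have sideF e : e \in E -> exists x y, e = [set x; y] /\
    sole_cut F (side_partition (edge_side E e)) x y.
  move=> Ee; have [x [y [defe _ cutxy]]] := edgeP e Ee.
  exists x, y; split=> // _ /imsetP[f Ef ->]; rewrite cuts_side cutxy //.
  apply/eqP/eqP=> [-> //|]; exact: side_partition_inj dual _ _ Ef Ee.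
exists F; split=> //; apply/setP=> e; apply/idP/idP=> [Ge|Ee]; last first.
  have [x [y [defe cutxy]]] := sideF e Ee; rewrite defe.
  apply/separation_graphP; exists (side_partition (edge_side E e)) => //.
  exact: imset_f.
have := subsetP (separation_graph_complete F) e Ge; rewrite inE.
case/cards2P=> u [v [_ defe]]; move: Ge; rewrite defe.
(* The sole cutter of this pair comes from some [f] in [E], and it has only one sole pair, so the
   pair is [f]. *)
case/separation_graphP=> P FP cutuv; have /imsetP[f Ef defP] := FP.
have [x [y [deff cutxy]]] := sideF f Ef; rewrite -defP in cutxy.
by rewrite -(sole_cut_inj minF cardF FP cutxy cutuv) -deff.
Qed.

End Families.

Theorem theorem2p2 (T : finType) (T_nonempty : 0 < #|T|) :
  [/\ (* well defined *)
      forall F : {set {set {set T}}},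
        maximum_minimal_separating_family F ->
        spanning_tree (separation_graph F),
      (* injective *)
      forall F1 F2 : {set {set {set T}}},
        maximum_minimal_separating_family F1 ->
        maximum_minimal_separating_family F2 ->
        separation_graph F1 = separation_graph F2 -> F1 = F2
    & (* surjective *)
      forall E : {set {set T}}, spanning_tree E ->
        exists2 F : {set {set {set T}}},
          maximum_minimal_separating_family F & separation_graph F = E].
Proof.
split=> [F /maximum_minimal_card[] // minF cardF | F1 F2 | E treeE].
- exact: largest_spanning_tree.
- case/maximum_minimal_card=> // min1 card1.
  case/maximum_minimal_card=> // min2 card2 eqG.
  by apply/eqP; rewrite eqEsubset !largest_separation_graph_sub.
- have [F [minF cardF defE]] := spanning_tree_family T_nonempty treeE.
  by exists F => //; apply/maximum_minimal_card.
Qed.
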